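(* Let $\mathbb{F}$ be a finite field with $q$ elements, and let $\alpha,\beta\in\mathbb{F}$ with $\alpha\neq\beta$ and $\alpha,\beta\neq0$. Let $(D_2,t_{(\alpha,\beta)})$ be the algebra $D_2=\mathbb{F}\oplus\mathbb{F}$ with the trace $t_{(\alpha,\beta)}(a,b)=(\alpha a+\beta b)(1,1)$. Then $\mathrm{Id}(D_2,t_{(\alpha,\beta)})$ follows from (that is, is equal to the T-ideal generated by) the following polynomials: (i) $r(x_1,x_2)s(x_3,x_4)$, where $$r(x_1,x_2)=t(x_1)t(x_2)-\beta t(x_1x_2)-\alpha t(x_1)x_2-\alpha t(x_2)x_1+\alpha(\beta+\alpha)x_1x_2,$$ $$s(x_1,x_2)=t(x_1)t(x_2)-\alpha t(x_1x_2)-\beta t(x_1)x_2-\beta t(x_2)x_1+\beta(\beta+\alpha)x_1x_2;$$ (ii) $t(1)-(\alpha+\beta)1$; (iii) $x^q-x$; (iv) all Capelli polynomials of order $3$.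
   Context: Algebras are associative over $\mathbb{F}$. A trace on an algebra $\mathcal{A}$ is an $\mathbb{F}$-linear map $t:\mathcal{A}\to\mathcal{A}$ such that for all $a,b$: $t(a)\in Z(\mathcal{A})$, $t(ab)=t(ba)$, $t(t(a)b)=t(a)t(b)$. A trace algebra is an algebra with a trace. $\mathbb{F}\langle X,t\rangle$ denotes the free unital associative trace algebra freely generated by an infinite set $X$ of variables, i.e. the free algebra of the variety of unital associative algebras with a linear unary operation $t$ satisfying $t(x)y=yt(x)$, $t(xy)=t(yx)$, $t(t(x)y)=t(x)t(y)$ (here $t(1)$ is not assumed to be a scalar). For a unital trace algebra $(\mathcal{A},t)$, $\mathrm{Id}(\mathcal{A},t)\subseteq\mathbb{F}\langle X,t\rangle$ is the set of all trace polynomials vanishing under every substitution of the variables by elements of $\mathcal{A}$. A T-ideal is a two-sided ideal of $\mathbb{F}\langle X,t\rangle$ closed under $t$ and under all (trace-algebra) endomorphisms of $\mathbb{F}\langle X,t\rangle$; $\langle S\rangle$ is the smallest T-ideal containing $S$. ''$\mathrm{Id}(\mathcal{A},t)$ follows from $S$'' means $\mathrm{Id}(\mathcal{A},t)=\langle S\rangle$. A Capelli polynomial of order $m$ is a multilinear polynomial $f(x_1,\ldots,x_m,y_1,\ldots,y_r)\in\mathbb{F}\langle X,t\rangle$ that is alternating in $\{x_1,\ldots,x_m\}$. In the paper, each Capelli polynomial of order $m$ is a consequence of $[x,y]=xy-yx$ and the single polynomial $\sum_{\sigma\in\mathcal{S}_m}(-1)^\sigma t(y_1x_{\sigma(1)})\cdots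 t(y_{m-1}x_{\sigma(m-1)})y_mx_{\sigma(m)}$, where $(-1)^\sigma$ is the sign of $\sigma$. *)

(* Defs.v *)
From HB Require Import structures.
From mathcomp Require Import all_boot all_algebra.
From mathcomp Require Import boolp classical_sets.

Set Implicit Arguments.
Unset Strict Implicit.
Unset Printing Implicit Defensive.

Import GRing.Theory.
Local Open Scope ring_scope.
Local Open Scope classical_set_scope.
Local Open Scope quotient_scope.

(* tr 1 is only required to be central, not to be a scalar. *)
HB.mixin Record Algebra_hasTrace (F : fieldType) A of GRing.Algebra F A := {
  tr : A -> A;
  tr_is_linear : linear tr;
  tr_central : forall a b : A, tr a * b = b * tr a;
  tr_cyclic : forall a b : A, tr (a * b) = tr (b * a);
  tr_tr : forall a b : A, tr (tr a * b) = tr a * tr b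
}.

#[short(type="traceAlgType")]
HB.structure Definition TraceAlgebra (F : fieldType) :=
  {A of Algebra_hasTrace F A & GRing.Algebra F A}.

HB.instance Definition _ (F : fieldType) (A : traceAlgType F) :=
  GRing.isLinear.Build F A A *:%R (@tr F A) (@tr_is_linear F A).

(* The free trace algebra F<X,t> is the algebra of terms in the signature of   *)
(* unital trace algebras, modulo the congruence generated by the axioms.       *)
Inductive tterm (F X : Type) : Type :=
| TVar of X
| TZero
| TOne
| TOpp of tterm F X
| TAdd of tterm F X & tterm F X
| TScale of F & tterm F X
| TMul of tterm F X & tterm F X
| TTr of tterm F X.

Arguments TVar {F X}.
Arguments TZero {F X}.
Arguments TOne {F X}.

Inductive tcongr (F : fieldType) (X : Type) : tterm F X -> tterm F X -> Prop :=
| tc_refl u : tcongr u u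
| tc_sym u v : tcongr u v -> tcongr v u
| tc_trans u v w : tcongr u v -> tcongr v w -> tcongr u w
| tc_opp u u' : tcongr u u' -> tcongr (TOpp u) (TOpp u')
| tc_add u u' v v' :
    tcongr u u' -> tcongr v v' -> tcongr (TAdd u v) (TAdd u' v')
| tc_scale c u u' : tcongr u u' -> tcongr (TScale c u) (TScale c u')
| tc_mul u u' v v' :
    tcongr u u' -> tcongr v v' -> tcongr (TMul u v) (TMul u' v')
| tc_tr u u' : tcongr u u' -> tcongr (TTr u) (TTr u')
| tc_addA u v w : tcongr (TAdd u (TAdd v w)) (TAdd (TAdd u v) w)
| tc_addC u v : tcongr (TAdd u v) (TAdd v u)
| tc_add0 u : tcongr (TAdd TZero u) u
| tc_addN u : tcongr (TAdd (TOpp u) u) TZero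
| tc_scaleA c d u : tcongr (TScale c (TScale d u)) (TScale (c * d) u)
| tc_scale1 u : tcongr (TScale 1 u) u
| tc_scaleDr c u v :
    tcongr (TScale c (TAdd u v)) (TAdd (TScale c u) (TScale c v))
| tc_scaleDl u c d :
    tcongr (TScale (c + d) u) (TAdd (TScale c u) (TScale d u))
| tc_mulA u v w : tcongr (TMul u (TMul v w)) (TMul (TMul u v) w)
| tc_mul1l u : tcongr (TMul TOne u) u
| tc_mul1r u : tcongr (TMul u TOne) u
| tc_mulDl u v w : tcongr (TMul (TAdd u v) w) (TAdd (TMul u w) (TMul v w))
| tc_mulDr u v w : tcongr (TMul u (TAdd v w)) (TAdd (TMul u v) (TMul u w))
| tc_scaleAl c u v : tcongr (TScale c (TMul u v)) (TMul (TScale c u) v)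
| tc_scaleAr c u v : tcongr (TScale c (TMul u v)) (TMul u (TScale c v))
| tc_trD u v : tcongr (TTr (TAdd u v)) (TAdd (TTr u) (TTr v))
| tc_trZ c u : tcongr (TTr (TScale c u)) (TScale c (TTr u))
| tc_tr_central u v : tcongr (TMul (TTr u) v) (TMul v (TTr u))
| tc_tr_cyclic u v : tcongr (TTr (TMul u v)) (TTr (TMul v u))
| tc_tr_tr u v : tcongr (TTr (TMul (TTr u) v)) (TMul (TTr u) (TTr v)).

Fixpoint term_eval (F : fieldType) (A : traceAlgType F) (X : Type)
    (nu : X -> A) (u : tterm F X) : A :=
  match u with
  | TVar x => nu x
  | TZero => 0
  | TOne => 1
  | TOpp u => - term_eval nu u
  | TAdd u v => term_eval nu u + term_eval nu v
  | TScale c u => c *: term_eval nu u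
  | TMul u v => term_eval nu u * term_eval nu v
  | TTr u => tr (term_eval nu u)
  end.

Lemma term_eval_congr (F : fieldType) (A : traceAlgType F) (X : Type)
    (nu : X -> A) (u v : tterm F X) :
  tcongr u v -> term_eval nu u = term_eval nu v.
Proof.
elim=> //=; intros; rewrite ?addrA ?add0r ?addNr ?scalerA ?scale1r ?scalerDr
  ?scalerDl ?mulrA ?mul1r ?mulr1 ?mulrDl ?mulrDr ?scalerAl ?linearD ?linearZ //;
  try congruence.
- by rewrite addrC.
- by rewrite -scalerAl scalerAr.
- exact: tr_central.
- exact: tr_cyclic.
- exact: tr_tr.
Qed.

(* The ground field as a trace algebra with the identity as trace; it is used  *)
(* to show that the free trace algebra is nontrivial.                          *)
Definition id_trace_alg (F : fieldType) : Type := F^o.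
HB.instance Definition _ (F : fieldType) := GRing.Algebra.on (id_trace_alg F).

Lemma id_is_linear (F : fieldType) : linear (@id (id_trace_alg F)).
Proof. by []. Qed.

HB.instance Definition _ (F : fieldType) :=
  Algebra_hasTrace.Build F (id_trace_alg F) (@id_is_linear F)
    (fun a b => mulrC (a : F) b) (fun a b => mulrC (a : F) b)
    (fun a b => erefl).

Section FreeTraceAlgebra.
Variables (F : fieldType) (X : Type).
Implicit Types u v w : tterm F X.

HB.instance Definition _ := gen_eqMixin (tterm F X).
HB.instance Definition _ := gen_choiceMixin (tterm F X).

Definition tcongrb u v : bool := `[< tcongr u v >].

Lemma tcongrb_equiv : equiv_class_of tcongrb.
Proof.
split=> [u|u v|v u w].
- by apply/asboolP; apply: tc_refl.
- by apply/asboolP/asboolP; apply: tc_sym.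
- by move=> /asboolP uv /asboolP vw; apply/asboolP; apply: tc_trans uv vw.
Qed.

Canonical tcongr_equiv := EquivRelPack tcongrb_equiv.

Definition freeTrace : Type := {eq_quot tcongr_equiv}.
HB.instance Definition _ := Choice.on freeTrace.
HB.instance Definition _ := EqQuotient.on freeTrace.

Local Notation pi u := (\pi_freeTrace u).

Lemma freeTrace_eqP u v : (pi u = pi v) <-> tcongr u v.
Proof.
split=> [/eqmodP|uv]; first by move/asboolP.
by apply/eqmodP/asboolP.
Qed.

Lemma freeTrace_ind (P : freeTrace -> Prop) :
  (forall u, P (pi u)) -> forall f, P f.
Proof. by move=> Ppi f; rewrite -[f]reprK. Qed.

Lemma repr_congr u : tcongr (repr (pi u)) u.
Proof. by apply/freeTrace_eqP; rewrite reprK. Qed.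

Definition ft_zero : freeTrace := pi TZero.
Definition ft_one : freeTrace := pi TOne.
Definition ft_opp (f : freeTrace) : freeTrace := pi (TOpp (repr f)).
Definition ft_add (f g : freeTrace) : freeTrace := pi (TAdd (repr f) (repr g)).
Definition ft_scale (c : F) (f : freeTrace) : freeTrace :=
  pi (TScale c (repr f)).
Definition ft_mul (f g : freeTrace) : freeTrace := pi (TMul (repr f) (repr g)).
Definition ft_tr (f : freeTrace) : freeTrace := pi (TTr (repr f)).

Lemma pi_oppE u : ft_opp (pi u) = pi (TOpp u).
Proof. by apply/freeTrace_eqP; apply: tc_opp; apply: repr_congr. Qed.
Lemma pi_addE u v : ft_add (pi u) (pi v) = pi (TAdd u v).
Proof. by apply/freeTrace_eqP; apply: tc_add; apply: repr_congr. Qed.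
Lemma pi_scaleE c u : ft_scale c (pi u) = pi (TScale c u).
Proof. by apply/freeTrace_eqP; apply: tc_scale; apply: repr_congr. Qed.
Lemma pi_mulE u v : ft_mul (pi u) (pi v) = pi (TMul u v).
Proof. by apply/freeTrace_eqP; apply: tc_mul; apply: repr_congr. Qed.
Lemma pi_trE u : ft_tr (pi u) = pi (TTr u).
Proof. by apply/freeTrace_eqP; apply: tc_tr; apply: repr_congr. Qed.

Definition ft_piE :=
  (pi_oppE, pi_addE, pi_scaleE, pi_mulE, pi_trE).

Lemma ft_addA : associative ft_add.
Proof.
elim/freeTrace_ind=> u; elim/freeTrace_ind=> v; elim/freeTrace_ind=> w.
by rewrite !ft_piE; apply/freeTrace_eqP; apply: tc_addA.
Qed.
Lemma ft_addC : commutative ft_add.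
Proof.
elim/freeTrace_ind=> u; elim/freeTrace_ind=> v.
by rewrite !ft_piE; apply/freeTrace_eqP; apply: tc_addC.
Qed.
Lemma ft_add0 : left_id ft_zero ft_add.
Proof.
elim/freeTrace_ind=> u.
by rewrite !ft_piE; apply/freeTrace_eqP; apply: tc_add0.
Qed.
Lemma ft_addN : left_inverse ft_zero ft_opp ft_add.
Proof.
elim/freeTrace_ind=> u.
by rewrite !ft_piE; apply/freeTrace_eqP; apply: tc_addN.
Qed.

HB.instance Definition _ :=
  GRing.isZmodule.Build freeTrace ft_addA ft_addC ft_add0 ft_addN.

Lemma ft_piD u v : pi u + pi v = pi (TAdd u v). Proof. exact: pi_addE. Qed.

Lemma ft_mulA : associative ft_mul.
Proof.
elim/freeTrace_ind=> u; elim/freeTrace_ind=> v; elim/freeTrace_ind=> w.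
by rewrite !ft_piE; apply/freeTrace_eqP; apply: tc_mulA.
Qed.
Lemma ft_mul1l : left_id ft_one ft_mul.
Proof.
elim/freeTrace_ind=> u.
by rewrite !ft_piE; apply/freeTrace_eqP; apply: tc_mul1l.
Qed.
Lemma ft_mul1r : right_id ft_one ft_mul.
Proof.
elim/freeTrace_ind=> u.
by rewrite !ft_piE; apply/freeTrace_eqP; apply: tc_mul1r.
Qed.
Lemma ft_mulDl : left_distributive ft_mul +%R.
Proof.
elim/freeTrace_ind=> u; elim/freeTrace_ind=> v; elim/freeTrace_ind=> w.
rewrite ft_piD !ft_piE ft_piD.
by apply/freeTrace_eqP; apply: tc_mulDl.
Qed.
Lemma ft_mulDr : right_distributive ft_mul +%R.
Proof.
elim/freeTrace_ind=> u; elim/freeTrace_ind=> v; elim/freeTrace_ind=> w.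
rewrite ft_piD !ft_piE ft_piD.
by apply/freeTrace_eqP; apply: tc_mulDr.
Qed.
Lemma ft_one_neq0 : ft_one != 0.
Proof.
apply/eqP => /freeTrace_eqP.
move/(term_eval_congr (fun _ : X => 0 : id_trace_alg F)) => /= /eqP.
by rewrite oner_eq0.
Qed.

HB.instance Definition _ :=
  GRing.Zmodule_isNzRing.Build freeTrace
    ft_mulA ft_mul1l ft_mul1r ft_mulDl ft_mulDr ft_one_neq0.

Lemma ft_scaleA c d (f : freeTrace) :
  ft_scale c (ft_scale d f) = ft_scale (c * d) f.
Proof.
elim/freeTrace_ind: f => u.
by rewrite !ft_piE; apply/freeTrace_eqP; apply: tc_scaleA.
Qed.
Lemma ft_scale1 : left_id 1 ft_scale.
Proof.
elim/freeTrace_ind=> u.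
by rewrite !ft_piE; apply/freeTrace_eqP; apply: tc_scale1.
Qed.
Lemma ft_scaleDr : right_distributive ft_scale +%R.
Proof.
move=> c; elim/freeTrace_ind=> u; elim/freeTrace_ind=> v.
rewrite ft_piD !ft_piE ft_piD.
by apply/freeTrace_eqP; apply: tc_scaleDr.
Qed.
Lemma ft_scaleDl (f : freeTrace) : {morph ft_scale^~ f : c d / c + d}.
Proof.
move=> c d; elim/freeTrace_ind: f => u; rewrite !ft_piE ft_piD.
by apply/freeTrace_eqP; apply: tc_scaleDl.
Qed.

HB.instance Definition _ :=
  GRing.Zmodule_isLmodule.Build F freeTrace
    ft_scaleA ft_scale1 ft_scaleDr ft_scaleDl.

Lemma ft_scaleAl (c : F) (f g : freeTrace) : c *: (f * g) = (c *: f) * g.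
Proof.
elim/freeTrace_ind: f => u; elim/freeTrace_ind: g => v.
rewrite /GRing.scale /GRing.mul /= !ft_piE.
by apply/freeTrace_eqP; apply: tc_scaleAl.
Qed.
Lemma ft_scaleAr (c : F) (f g : freeTrace) : c *: (f * g) = f * (c *: g).
Proof.
elim/freeTrace_ind: f => u; elim/freeTrace_ind: g => v.
rewrite /GRing.scale /GRing.mul /= !ft_piE.
by apply/freeTrace_eqP; apply: tc_scaleAr.
Qed.

HB.instance Definition _ := GRing.Lmodule_isLalgebra.Build F freeTrace ft_scaleAl.
HB.instance Definition _ := GRing.Lalgebra_isAlgebra.Build F freeTrace ft_scaleAr.

Lemma ft_tr_is_linear : linear ft_tr.
Proof.
move=> c; elim/freeTrace_ind=> u; elim/freeTrace_ind=> v.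
rewrite /GRing.scale /GRing.add /= !ft_piE; apply/freeTrace_eqP.
by apply: tc_trans (tc_trD _ _) _; apply: tc_add (tc_trZ _ _) (tc_refl _).
Qed.
Lemma ft_tr_central (f g : freeTrace) : ft_tr f * g = g * ft_tr f.
Proof.
elim/freeTrace_ind: f => u; elim/freeTrace_ind: g => v.
rewrite /GRing.mul /= !ft_piE.
by apply/freeTrace_eqP; apply: tc_tr_central.
Qed.
Lemma ft_tr_cyclic (f g : freeTrace) : ft_tr (f * g) = ft_tr (g * f).
Proof.
elim/freeTrace_ind: f => u; elim/freeTrace_ind: g => v.
rewrite /GRing.mul /= !ft_piE.
by apply/freeTrace_eqP; apply: tc_tr_cyclic.
Qed.
Lemma ft_tr_tr (f g : freeTrace) : ft_tr (ft_tr f * g) = ft_tr f * ft_tr g.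
Proof.
elim/freeTrace_ind: f => u; elim/freeTrace_ind: g => v.
rewrite /GRing.mul /= !ft_piE.
by apply/freeTrace_eqP; apply: tc_tr_tr.
Qed.

HB.instance Definition _ :=
  Algebra_hasTrace.Build F freeTrace
    ft_tr_is_linear ft_tr_central ft_tr_cyclic ft_tr_tr.

Definition var (x : X) : freeTrace := pi (TVar x).

Definition teval (A : traceAlgType F) (nu : X -> A) (f : freeTrace) : A :=
  term_eval nu (repr f).

Section Eval.
Variables (A : traceAlgType F) (nu : X -> A).

Lemma teval_pi u : teval nu (pi u) = term_eval nu u.
Proof. by apply: term_eval_congr; apply: repr_congr. Qed.

Lemma teval_var x : teval nu (var x) = nu x.
Proof. exact: teval_pi. Qed.

Lemma teval_is_linear : linear (teval nu).
Proof.
move=> c; elim/freeTrace_ind=> u; elim/freeTrace_ind=> v.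
by rewrite /GRing.scale /GRing.add /= !ft_piE !teval_pi.
Qed.

Lemma teval_is_monoid_morphism : monoid_morphism (teval nu).
Proof.
split; first exact: teval_pi.
elim/freeTrace_ind=> u; elim/freeTrace_ind=> v.
by rewrite {1}/GRing.mul /= !ft_piE !teval_pi.
Qed.

HB.instance Definition _ :=
  GRing.isLinear.Build F freeTrace A *:%R (teval nu) teval_is_linear.
HB.instance Definition _ :=
  GRing.isMonoidMorphism.Build freeTrace A (teval nu) teval_is_monoid_morphism.

Lemma teval_tr f : teval nu (tr f) = tr (teval nu f).
Proof.
by elim/freeTrace_ind: f => u; rewrite /tr /= ft_piE !teval_pi.
Qed.

Lemma teval_unique (phi : {lrmorphism freeTrace -> A}) :
    (forall f, phi (tr f) = tr (phi f)) -> (forall x, phi (var x) = nu x) ->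
  forall f, phi f = teval nu f.
Proof.
move=> phi_tr phi_var; elim/freeTrace_ind=> u; rewrite teval_pi.
elim: u => [x|||u IHu|u IHu v IHv|c u IHu|u IHu v IHv|u IHu] /=.
- exact: phi_var.
- exact: (raddf0 phi).
- exact: (rmorph1 phi).
- by rewrite -IHu -raddfN; congr (phi _); rewrite -pi_oppE.
- by rewrite -IHu -IHv -raddfD; congr (phi _); rewrite -pi_addE.
- by rewrite -IHu -linearZ; congr (phi _); rewrite -pi_scaleE.
- by rewrite -IHu -IHv -rmorphM; congr (phi _); rewrite -pi_mulE.
- by rewrite -IHu -phi_tr; congr (phi _); rewrite -pi_trE.
Qed.

End Eval.

End FreeTraceAlgebra.

Arguments var F {X} x.

Definition Id (F : fieldType) (X : Type) (A : traceAlgType F) :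
    set (freeTrace F X) :=
  [set f | forall nu : X -> A, teval nu f = 0].

Arguments Id {F} X A.

(* Stability under scalars follows from stability under products by c%:A. *)
Definition T_ideal (F : fieldType) (A : traceAlgType F) (I : set A) : Prop :=
  [/\ I 0, (forall a b, I a -> I b -> I (a + b)),
      (forall a b, I b -> I (a * b) /\ I (b * a)),
      (forall a, I a -> I (tr a))
    & forall phi : {lrmorphism A -> A}, (forall a, phi (tr a) = tr (phi a)) ->
        forall a, I a -> I (phi a)].

Definition T_ideal_gen (F : fieldType) (A : traceAlgType F) (S : set A) : set A :=
  smallest (@T_ideal F A) S.

Section Capelli.
Variables (F : fieldType) (X : eqType).

(* [trace_monomial s m]: m is a trace monomial, and s lists the occurrences of *)
(* variables in m, with multiplicity.                                          *)
Inductive trace_monomial : seq X -> freeTrace F X -> Prop :=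
| monomial1 : trace_monomial [::] 1
| monomial_var x : trace_monomial [:: x] (var F x)
| monomialM s1 s2 m1 m2 : trace_monomial s1 m1 -> trace_monomial s2 m2 ->
    trace_monomial (s1 ++ s2) (m1 * m2)
| monomial_tr s m : trace_monomial s m -> trace_monomial s (tr m).

(* Over a finite field multilinearity has to be read on monomials: for         *)
(* q = #|F|, the substitution a |-> tr(a)^q is also additive and F-linear.     *)
Definition multilinear (zs : seq X) (f : freeTrace F X) : Prop :=
  exists r : seq (F * freeTrace F X),
    (forall cm, cm \in r ->
       exists2 s, perm_eq s zs & trace_monomial s cm.2) /\
    f = \sum_(cm <- r) cm.1 *: cm.2.

(* In characteristic 2 this is stronger than changing sign under the           *)
(* transpositions of xs.                                                       *)
Definition alternating (xs : seq X) (f : freeTrace F X) : Prop :=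
  forall x y, x \in xs -> y \in xs -> x != y ->
    teval (fun z => var F (if z == x then y else z)) f = 0.

Definition capelli (m : nat) (f : freeTrace F X) : Prop :=
  exists xs ys : seq X,
    [/\ size xs = m, uniq (xs ++ ys), multilinear (xs ++ ys) f
      & alternating xs f].

End Capelli.

Definition D2 (F : fieldType) (alpha beta : F) : Type := (F^o * F^o)%type.

Section D2.
Variables (F : fieldType) (alpha beta : F).

HB.instance Definition _ := GRing.Algebra.on (D2 alpha beta).

Definition D2_tr (a : D2 alpha beta) : D2 alpha beta :=
  (alpha * a.1 + beta * a.2 : F) *: 1.

Lemma D2_tr_is_linear : linear D2_tr.
Proof.
move=> c [a1 a2] [b1 b2]; rewrite /D2_tr scalerA -scalerDl.
congr (_ *: _).
change (alpha * (c * a1 + b1) + beta * (c * a2 + b2) =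
        c * (alpha * a1 + beta * a2) + (alpha * b1 + beta * b2) :> F).
by rewrite (mulrDr alpha) (mulrDr beta) (mulrDr c) addrACA !(mulrCA _ c).
Qed.

Lemma D2_tr_central (a b : D2 alpha beta) : D2_tr a * b = b * D2_tr a.
Proof. by rewrite /D2_tr -scalerAl -scalerAr mul1r mulr1. Qed.

Lemma D2_tr_cyclic (a b : D2 alpha beta) : D2_tr (a * b) = D2_tr (b * a).
Proof.
case: a b => [a1 a2] [b1 b2]; congr (_ *: _).
change (alpha * (a1 * b1) + beta * (a2 * b2) =
        alpha * (b1 * a1) + beta * (b2 * a2) :> F).
by rewrite (mulrC a1) (mulrC a2).
Qed.

Lemma D2_tr_tr (a b : D2 alpha beta) : D2_tr (D2_tr a * b) = D2_tr a * D2_tr b.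
Proof.
have trZ c d : D2_tr (c *: d) = c *: D2_tr d.
  have tr0 : D2_tr 0 = 0.
    by apply: (addrI (D2_tr 0)); rewrite -{1}[D2_tr 0]scale1r -D2_tr_is_linear
      scaler0 !addr0.
  by rewrite -[c *: d]addr0 D2_tr_is_linear tr0 addr0.
by rewrite [D2_tr a]/D2_tr -!scalerAl !mul1r trZ.
Qed.

HB.instance Definition _ :=
  Algebra_hasTrace.Build F (D2 alpha beta)
    D2_tr_is_linear D2_tr_central D2_tr_cyclic D2_tr_tr.

End D2.

Section Generators.
Variables (F : fieldType) (A : traceAlgType F) (alpha beta : F).

Definition r_poly (a b : A) : A :=
  tr a * tr b - beta *: tr (a * b) - alpha *: (tr a * b) - alpha *: (tr b * a)
  + (alpha * (beta + alpha)) *: (a * b).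

Definition s_poly (a b : A) : A :=
  tr a * tr b - alpha *: tr (a * b) - beta *: (tr a * b) - beta *: (tr b * a)
  + (beta * (beta + alpha)) *: (a * b).

End Generators.

(* Main.v *)
Require Import Defs.
From HB Require Import structures.
From mathcomp Require Import all_boot all_algebra finfield ring.
From mathcomp Require Import boolp classical_sets.

(** Why the theorem is true.

    The listed polynomials are identities of D2: r has first coordinate 0 and s
    has second coordinate 0, so r s = 0; and a multilinear polynomial that
    alternates in three variables vanishes because D2 is spanned by two vectors,
    so that after expanding the three arguments two of them coincide.

    Conversely, let I be a T-ideal containing the listed polynomials, and let f
    be outside I. The identity x^q = x modulo I produces a character, that is, a
    unital algebra morphism chi : F<X,t> -> F, that kills I but not f
    ([exists_character]): a two-sided ideal P containing I and maximal among those
    avoiding f has F as its quotient. Since chi kills every value of r s and F is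
    a field, chi kills all values of r or all values of s, and exchanging alpha and
    beta exchanges r and s. If chi kills the values of r, put
      psi (a) = (chi (t a) - alpha chi (a)) / beta.
    Then chi (r (a, b)) = 0 says that beta^2 psi (a) psi (b) = beta^2 psi (ab),
    and t(1) = alpha + beta gives both psi (1) = 1 and psi (t a) = chi (t a)
    ([trace_character]). Hence a |-> (chi (a), psi (a)) is a morphism of trace
    algebras from F<X,t> to (D2, t), so that an identity of D2 is killed by chi;
    as chi (f) <> 0, f is not an identity of D2. *)

Set Implicit Arguments.
Unset Strict Implicit.
Unset Printing Implicit Defensive.

Import GRing.Theory.
Local Open Scope ring_scope.
Local Open Scope classical_set_scope.

(** * Two-sided ideals modulo which x^q = x *)

Section Ideals.
Variable R : nzRingType.
Implicit Types (I P : set R) (a b x y z f g h : R).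

Definition ideal I : Prop :=
  [/\ I 0, (forall a b, I a -> I b -> I (a + b))
    & forall a b, I b -> I (a * b) /\ I (b * a)].

Section Closure.
Variables (I : set R) (idealI : ideal I).

Lemma ideal0 : I 0. Proof. by case: idealI. Qed.
Lemma idealD a b : I a -> I b -> I (a + b).
Proof. by case: idealI => _ + _; apply. Qed.
Lemma idealMl a b : I b -> I (a * b).
Proof. by case: idealI => _ _ IM /(IM a)[]. Qed.
Lemma idealMr a b : I b -> I (b * a).
Proof. by case: idealI => _ _ IM /(IM a)[]. Qed.
Lemma idealB a b : I a -> I b -> I (a - b).
Proof. by move=> Ia Ib; apply: idealD => //; rewrite -mulN1r; apply: idealMl. Qed.

End Closure.

(** Zorn's lemma for unions also asks for the empty chain, whose union is empty and
    is not an ideal; so it is applied to the sets A for which I `|` A is an ideal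
    avoiding f. *)
Lemma maximal_ideal_avoiding I f : ideal I -> ~ I f ->
  exists P, [/\ ideal P, I `<=` P, ~ P f &
    forall Q, ideal Q -> P `<=` Q -> ~ Q f -> Q `<=` P].
Proof.
move=> idI nIf.
have [|A [[idA nAf] Amax]] :=
  @Zorn_bigcup R (fun A => ideal (I `|` A) /\ ~ (I `|` A) f).
- move=> C CP Ctot; split; last first.
    by case=> // -[A CA Af]; apply: (CP A CA).2; right.
  have in_member a A : C A -> (I `|` A) a -> (I `|` \bigcup_(B in C) B) a.
    by move=> CA [Ia|Aa]; [left | right; exists A].
  split; first by left; apply: ideal0 idI.
  + move=> a b [Ia|[A CA Aa]] [Ib|[B CB Bb]].
    * by left; apply: idealD.
    * by apply: (in_member _ _ CB); apply: (idealD (CP _ CB).1); [left|right].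
    * by apply: (in_member _ _ CA); apply: (idealD (CP _ CA).1); [right|left].
    * have [AB|BA] := Ctot _ _ CA CB.
        apply: (in_member _ _ CB); apply: (idealD (CP _ CB).1); right=> //.
        exact: AB.
      apply: (in_member _ _ CA); apply: (idealD (CP _ CA).1); right=> //.
      exact: BA.
  + move=> a b [Ib|[B CB Bb]].
      by split; left; [apply: idealMl | apply: idealMr].
    have IBb : (I `|` B) b by right.
    split; apply: (in_member _ _ CB); first exact: (idealMl (CP _ CB).1).
    exact: (idealMr (CP _ CB).1).
exists (I `|` A); split=> // Q idQ IAQ nQf.
have IQ : I `|` Q = Q.
  by apply/seteqP; split=> x; [case=> // Ix; apply: IAQ; left | right].
move=> x Qx; right; apply: contrapT => nAx; apply: (Amax Q); last by rewrite IQ.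
split; last by move=> QA; apply: nAx; apply: QA.
by move=> y Ay; apply: IAQ; right.
Qed.

Section PowerIdentity.
Variables (P : set R) (idealP : ideal P) (q : nat).
Hypotheses (q_gt1 : (1 < q)%N) (powP : forall x, P (x ^+ q - x)).

(** Modulo P, x^q = x, and x^q is a multiple of x^2 because q > 1. *)
Lemma ideal_reduced x : P (x * x) -> P x.
Proof.
move=> Pxx; rewrite -[x](subKr (x ^+ q)); apply: (idealB idealP) => //.
rewrite -(subnK q_gt1) addn2 !exprSr -mulrA.
exact: (idealMl idealP).
Qed.

Lemma ideal_power_idempotent y : P (y ^+ q.-1 * y ^+ q.-1 - y ^+ q.-1).
Proof.
have -> : y ^+ q.-1 * y ^+ q.-1 - y ^+ q.-1 = y ^+ q.-2 * (y ^+ q - y).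
  by rewrite mulrBr -!exprD -exprSr; congr (y ^+ _ - y ^+ _);
    case: q q_gt1 => [|[|k]] //= _; rewrite addSnnS.
exact: (idealMl idealP).
Qed.

(** In a reduced ring idempotents are central: g x (1 - g) and (1 - g) x g have
    square zero, and g x - x g is their difference. *)
Lemma ideal_idempotent_central g x : P (g * g - g) -> P (g * x - x * g).
Proof.
move=> Pgg.
have Pgg' : P ((1 - g) * g).
  by rewrite mulrBl mul1r -opprB -mulN1r; apply: (idealMl idealP).
have Pgg'' : P (g * (1 - g)).
  by rewrite mulrBr mulr1 -opprB -mulN1r; apply: (idealMl idealP).
have -> : g * x - x * g = g * x * (1 - g) - (1 - g) * x * g.
  by rewrite mulrBr mulr1 !mulrBl mul1r opprB addrA subrK.
apply: (idealB idealP); apply: ideal_reduced.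
  rewrite -!mulrA; apply: (idealMl idealP); apply: (idealMl idealP).
  by rewrite (mulrA (1 - g)); apply: (idealMr idealP).
rewrite -!mulrA; apply: (idealMl idealP); apply: (idealMl idealP).
by rewrite (mulrA g); apply: (idealMr idealP).
Qed.

(** Centrality of h modulo P is what makes this colon ideal two-sided. *)
Lemma ideal_colon h : (forall x, P (h * x - x * h)) ->
  ideal [set z | P (z * h)].
Proof.
move=> hC; split=> /= [|a b Pa Pb|a b Pb].
- by rewrite mul0r; apply: ideal0.
- by rewrite mulrDl; apply: idealD.
- rewrite -mulrA; split; first exact: (idealMl idealP).
  rewrite -mulrA; have -> : b * (a * h) = b * h * a - b * (h * a - a * h).
    by rewrite mulrBr !mulrA subKr.
  by apply: (idealB idealP); [apply: idealMr | apply: idealMl].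
Qed.

Variable f : R.
Hypotheses (nPf : ~ P f)
  (Pmax : forall Q, ideal Q -> P `<=` Q -> ~ Q f -> Q `<=` P).

(** The ideals (P : g) and (P : 1 - g) contain P, and f cannot lie in both since
    f = f g + f (1 - g). The one that avoids f is P by maximality, and it contains
    the complementary idempotent. *)
Lemma maximal_idempotent g : P (g * g - g) -> P g \/ P (1 - g).
Proof.
move=> Pgg.
have colon h : (forall x, P (h * x - x * h)) -> ~ P (f * h) ->
    forall z, P (z * h) -> P z.
  move=> hC nPfh z Pzh; apply: (Pmax (ideal_colon hC)) => // y Py /=.
  exact: (idealMr idealP).
have gC x : P (g * x - x * g) by apply: ideal_idempotent_central.
have [Pfg|nPfg] := pselect (P (f * g)).
  left; apply: (colon (1 - g)).
  - move=> x; rewrite mulrBl mulrBr mul1r mulr1 opprB addrC addrA subrK.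
    by rewrite -opprB -mulN1r; apply: (idealMl idealP).
  - move=> Pf1g; apply: nPf; rewrite -[f]mulr1 -(subrK g 1) mulrDr.
    exact: (idealD idealP).
  - by rewrite mulrBr mulr1 -opprB -mulN1r; apply: (idealMl idealP).
right; apply: (colon g) => //.
by rewrite mulrBl mul1r -opprB -mulN1r; apply: (idealMl idealP).
Qed.

(** The idempotent y^(q-1) generates the same ideal as y modulo P. When y is outside
    P, that idempotent is therefore 1 modulo P, and y^(q-2) is an inverse of y. *)
Lemma maximal_cancel y z : ~ P y -> P (z * y) -> P z.
Proof.
move=> nPy Pzy.
have q1 : q = q.-1.+1 by case: q q_gt1.
have q2 : q.-1 = q.-2.+1 by case: q q_gt1 => [|[]].
have [Pg|P1g] := maximal_idempotent (ideal_power_idempotent y).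
  case: nPy; rewrite -[y](subKr (y ^+ q)); apply: (idealB idealP) => //.
  by rewrite q1 exprS; apply: (idealMl idealP).
rewrite -[z]mulr1 -(subrK (y ^+ q.-1) 1) mulrDr.
apply: (idealD idealP); first exact: (idealMl idealP).
by rewrite q2 exprS mulrA; apply: (idealMr idealP).
Qed.

End PowerIdentity.
End Ideals.

(** If no a - c, for c in F, were in the maximal ideal P, all of them could be
    cancelled modulo P; but their product is a^q - a, which is in P. So every a is
    congruent modulo P to a scalar, and that scalar is chi (a). *)
Lemma exists_character (F : finFieldType) (A : algType F) (I : set A) (f : A) :
    ideal I -> (forall a, I (a ^+ #|F| - a)) -> ~ I f ->
  exists2 chi : {lrmorphism A -> F^o}, (forall a, I a -> chi a = 0) & chi f <> 0.
Proof.
move=> idI Ipow nIf; have q_gt1 := card_finNzRing_gt1 F.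
have [P [idP IP nPf Pmax]] := maximal_ideal_avoiding idI nIf.
have Ppow a : P (a ^+ #|F| - a) by apply: IP.
have nP1 : ~ P 1 by move=> P1; apply: nPf; rewrite -[f]mulr1; apply: (idealMl idP).
have PZ c a : P a -> P (c *: a).
  by move=> Pa; rewrite -[a]mul1r scalerAl; apply: (idealMl idP).
have res a : exists c : F, P (a - c%:A).
  apply: contrapT => no_res; apply: nP1.
  have cancel s z : P (z * \prod_(c <- s) (a - c%:A)) -> P z.
    elim: s z => [|c s IHs] z; first by rewrite big_nil mulr1.
    rewrite big_cons mulrA => /IHs.
    apply: (maximal_cancel idP q_gt1 Ppow nPf Pmax).
    by move=> Pac; apply: no_res; exists c.
  apply: (cancel (index_enum F)); rewrite mul1r.
  have -> : \prod_(c <- index_enum F) (a - c%:A) = a ^+ #|F| - a.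
    transitivity (horner_alg a ('X^#|F| - 'X)).
      rewrite finField_genPoly rmorph_prod; apply: eq_bigr => c _.
      by rewrite rmorphB /= horner_algX horner_algC.
    by rewrite rmorphB rmorphXn /= horner_algX.
  exact: Ppow.
have res_uniq a c d : P (a - c%:A) -> P (a - d%:A) -> c = d.
  move=> Pc Pd; apply: contrapT => /eqP; rewrite eq_sym -subr_eq0 => cd; apply: nP1.
  rewrite -(scale1r 1) -(mulVf cd) -scalerA; apply: PZ.
  rewrite scalerBl; have -> : d%:A - c%:A = (a - c%:A) - (a - d%:A) :> A.
    by rewrite opprB [RHS]addrC addrA subrK.
  exact: (idealB idP).
pose chi a : F^o := projT1 (cid (res a)).
have chiP a : P (a - (chi a)%:A) by rewrite /chi; case: cid.
have chi_eq a (c : F) : P (a - c%:A) -> chi a = c by apply: res_uniq.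
have chi_lin : linear chi.
  move=> c a b; apply: chi_eq.
  rewrite scalerDl -scalerA opprD addrACA -scalerBr.
  by apply: (idealD idP) => //; apply: PZ.
have chi_mul : monoid_morphism chi.
  split=> [|a b]; apply: chi_eq; first by rewrite scale1r subrr; apply: ideal0.
  have -> : a * b - (chi a * chi b : F)%:A =
      (a - (chi a)%:A) * b + chi a *: (b - (chi b)%:A).
    by rewrite mulrBl -scalerAl mul1r scalerBr scalerA addrA subrK.
  by apply: (idealD idP); [apply: (idealMr idP) | apply: PZ].
pose chiL := GRing.isLinear.Build _ _ _ _ chi chi_lin.
pose chiM := GRing.isMonoidMorphism.Build _ _ chi chi_mul.
pose chiLM : {lrmorphism A -> F^o} := HB.pack chi chiL chiM.
exists chiLM => [a Ia|]; first by apply: chi_eq; rewrite scale0r subr0; apply: IP.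
by move=> /= chif0; apply: nPf; have := chiP f; rewrite chif0 scale0r subr0.
Qed.

(** * From one character to a trace morphism into D2 *)

Lemma s_polyE (F : fieldType) (A : traceAlgType F) (alpha beta : F) (a b : A) :
  s_poly alpha beta a b = r_poly beta alpha a b.
Proof. by rewrite /s_poly /r_poly [beta + alpha]addrC. Qed.

(** A trace that satisfies the relation r under a character chi is, seen through
    chi, the weighted sum of chi and a second character psi. *)
Lemma trace_character (F : fieldType) (A : traceAlgType F) (alpha beta : F)
    (chi : {lrmorphism A -> F^o}) :
    beta != 0 -> chi (tr 1) = alpha + beta ->
    (forall a b, chi (r_poly alpha beta a b) = 0) ->
  exists psi : {lrmorphism A -> F^o},
    forall a, chi (tr a) = alpha * chi a + beta * psi a /\ psi (tr a) = chi (tr a).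
Proof.
move=> b0 chi_tr1 chi_r.
pose psi a : F^o := beta^-1 * (chi (tr a) - alpha * chi a).
have psi_lin : linear psi.
  move=> c a b; rewrite /psi !linearP /= /GRing.scale /=; ring.
have psi_mul : monoid_morphism psi.
  split=> [|a b].
    by rewrite /psi chi_tr1 rmorph1 mulr1 addrC addKr mulVf.
  (* ta, tb, tab, xa, xb are the values of chi at t(a), t(b), t(ab), a, b. *)
  have psi_field (ta tb tab xa xb : F) :
      ta * tb - beta * tab - alpha * (ta * xb) - alpha * (tb * xa)
        + alpha * (beta + alpha) * (xa * xb) = 0 ->
      beta^-1 * (tab - alpha * (xa * xb)) =
        beta^-1 * (ta - alpha * xa) * (beta^-1 * (tb - alpha * xb)).
    move=> r0; apply: (mulfI (mulf_neq0 b0 b0)); apply/eqP.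
    by rewrite -subr_eq0 -oppr_eq0 -r0; apply/eqP; field.
  rewrite /psi rmorphM; apply: psi_field; rewrite -(chi_r a b) /r_poly.
  by rewrite !(raddfB, raddfD) /= !linearZ /= !rmorphM !scalerN.
(* t(t(a)) = t(t(a) 1) = t(a) t(1), and t(1) is the scalar alpha + beta. *)
have psi_tr a : psi (tr a) = chi (tr a).
  have -> : psi (tr a) =
      beta^-1 * (chi (tr a) * (alpha + beta) - alpha * chi (tr a)).
    by rewrite /psi -[tr a in X in chi (tr X)]mulr1 tr_tr rmorphM /= chi_tr1.
  by field.
pose psiL := GRing.isLinear.Build _ _ _ _ psi psi_lin.
pose psiM := GRing.isMonoidMorphism.Build _ _ psi psi_mul.
exists (HB.pack psi psiL psiM : {lrmorphism A -> F^o}) => a.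
by split=> /=; [rewrite /psi mulrA divff // mul1r addrC subrK | exact: psi_tr].
Qed.

(** * Identities of a trace algebra form a T-ideal *)

Section FreeEvaluation.
Variables (F : fieldType) (X : Type).

Lemma teval_comp (A : traceAlgType F) (mu : X -> freeTrace F X) (nu : X -> A) f :
  teval nu (teval mu f) = teval (fun x => teval nu (mu x)) f.
Proof.
apply: (@teval_unique _ _ _ _ (teval nu \o teval mu)) => [g|x] /=.
  by rewrite !teval_tr.
by rewrite teval_var.
Qed.

Lemma teval_endo (A : traceAlgType F) (nu : X -> A)
    (phi : {lrmorphism freeTrace F X -> freeTrace F X}) :
  (forall f, phi (tr f) = tr (phi f)) ->
  forall f, teval nu (phi f) = teval (fun x => teval nu (phi (var F x))) f.
Proof.
move=> phi_tr f; rewrite -teval_comp.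
by rewrite (@teval_unique _ _ _ (fun x => phi (var F x)) phi).
Qed.

Lemma Id_T_ideal (A : traceAlgType F) : T_ideal (Id X A).
Proof.
split=> [nu|f g f0 g0 nu|f g g0|f f0 nu|phi phi_tr f f0 nu].
- exact: raddf0.
- by rewrite raddfD /= f0 g0 addr0.
- by split=> nu; rewrite rmorphM /= g0 ?mulr0 ?mul0r.
- by rewrite teval_tr f0 raddf0.
- by rewrite teval_endo.
Qed.

(** The two conditions say that (chi, psi) is a morphism of trace algebras to D2,
    hence the evaluation of trace polynomials at the images of the variables. *)
Lemma Id_D2_characters (alpha beta : F)
    (chi psi : {lrmorphism freeTrace F X -> F^o}) :
    (forall f, chi (tr f) = alpha * chi f + beta * psi f) ->
    (forall f, psi (tr f) = chi (tr f)) ->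
  forall f, Id X (D2 alpha beta) f -> chi f = 0 /\ psi f = 0.
Proof.
move=> chi_tr psi_tr f f0.
pose h g : D2 alpha beta := (chi g, psi g).
have h_lin : linear h by move=> c a b; rewrite /h !linearP.
have h_mul : monoid_morphism h.
  by split=> [|a b]; rewrite /h ?rmorph1 ?rmorphM.
pose hL := GRing.isLinear.Build _ _ _ _ h h_lin.
pose hM := GRing.isMonoidMorphism.Build _ _ h h_mul.
pose hLM : {lrmorphism freeTrace F X -> D2 alpha beta} := HB.pack h hL hM.
suff hf0 : h f = 0 by split; [exact: (congr1 fst hf0) | exact: (congr1 snd hf0)].
rewrite -(f0 (fun x => h (var F x))).
apply: (@teval_unique _ _ _ _ hLM) => //= g.
rewrite /h psi_tr chi_tr /tr /= /D2_tr /=.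
by congr pair; rewrite /GRing.scale /= mulr1.
Qed.

End FreeEvaluation.

(** * Capelli polynomials vanish on algebras of small dimension *)

Section CapelliSound.
Variables (F : fieldType) (X : eqType) (A : traceAlgType F).
Implicit Types (nu : X -> A) (f m : freeTrace F X).

Definition upd nu x v : X -> A := fun z => if z == x then v else nu z.

Lemma upd_id nu x : upd nu x (nu x) = nu.
Proof. by apply/funext=> z; rewrite /upd; case: eqP => [->|]. Qed.

Lemma teval_upd_notin s m : trace_monomial s m ->
  forall x nu v, x \notin s -> teval (upd nu x v) m = teval nu m.
Proof.
elim=> {s m} [|y|s1 s2 m1 m2 _ IH1 _ IH2|s m _ IH] x nu v.
- by rewrite !rmorph1.
- by rewrite inE !teval_var /upd eq_sym => /negPf->.
- by rewrite mem_cat negb_or => /andP[x1 x2]; rewrite !rmorphM /= IH1 ?IH2.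
- by move=> xs; rewrite !teval_tr IH.
Qed.

(** Products are linear in each factor and the trace is linear, and the unique
    occurrence of x lies in exactly one factor of a product. *)
Lemma teval_upd_linear s m : trace_monomial s m ->
  forall x nu, count_mem x s = 1%N -> linear (fun v => teval (upd nu x v) m).
Proof.
elim=> {s m} [|y|s1 s2 m1 m2 mon1 IH1 mon2 IH2|s m _ IH] x nu //=.
- rewrite addn0 => yx c u v; move: yx; rewrite !teval_var /upd.
  by case: (y == x).
- rewrite count_cat => cnt c u v; rewrite !rmorphM /=.
  case c1: (count_mem x s1) cnt => [|[|//]] cnt.
    have x1 : x \notin s1 by rewrite -has_pred1 has_count c1.
    by rewrite !(teval_upd_notin mon1 _ _ x1) IH2 // mulrDr scalerAr.
  have x2 : x \notin s2.
    by rewrite -has_pred1 has_count; move: cnt; rewrite add1n => -[->].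
  by rewrite !(teval_upd_notin mon2 _ _ x2) IH1 // mulrDl scalerAl.
- by move=> cnt c u v; rewrite !teval_tr IH // linearP.
Qed.

Lemma multilinear_upd_linear zs f x nu : multilinear zs f ->
  count_mem x zs = 1%N -> linear (fun v => teval (upd nu x v) f).
Proof.
move=> [r [rmon ->]] cnt c u v; rewrite /= !raddf_sum -big_split /=.
apply: eq_big_seq => cm /rmon[s /permP s_zs mon].
rewrite !linearZ /= (teval_upd_linear mon) ?s_zs //.
by rewrite scalerDr !scalerA mulrC.
Qed.

(** The assignment nu factors through the substitution of y for x, which kills f. *)
Lemma alternating_eq0 xs f nu x y : alternating xs f ->
  x \in xs -> y \in xs -> x != y -> nu x = nu y -> teval nu f = 0.
Proof.
move=> alt xxs yxs xy nuxy; rewrite -[RHS](raddf0 (teval nu)).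
rewrite -(alt _ _ xxs yxs xy) /= teval_comp; congr (teval _ f).
by apply/funext=> z; rewrite teval_var; case: eqP => [->|].
Qed.

(** Expanding the values of the alternating variables in the spanning family e, one
    may assume that they all lie in e; then two of them coincide, as m > size e. *)
Lemma capelli_Id (m : nat) (e : seq A) f :
    (forall v : A, exists c : A -> F, v = \sum_(w <- e) c w *: w) ->
    (size e < m)%N -> capelli m f -> Id X A f.
Proof.
move=> e_span lt_em [xs [ys [sz_xs uniq_xy mlin alt]]].
have uniq_xs : uniq xs by move: uniq_xy; rewrite cat_uniq => /and3P[].
(* s lists the alternating variables that are still to be expanded. *)
suff expand (s : seq X) nu : {subset s <= xs} ->
    (forall x, x \in xs -> x \notin s -> nu x \in e) -> teval nu f = 0.
  by move=> nu /=; apply: (expand xs nu) => // x ->.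
elim: s nu => [|x s IHs] nu s_xs nu_e.
  apply: contrapT => nuf; suff: (size xs <= size e)%N by rewrite leqNgt sz_xs lt_em.
  rewrite -(size_map nu); apply: uniq_leq_size; last first.
    by move=> _ /mapP[x xxs ->]; apply: nu_e.
  rewrite map_inj_in_uniq // => x y xxs yxs nuxy.
  by apply: contrapT => /eqP xy; apply: nuf; exact: (alternating_eq0 alt xxs yxs xy).
have x_xs : x \in xs by apply: s_xs; rewrite mem_head.
have lin : linear (fun v => teval (upd nu x v) f).
  apply: multilinear_upd_linear mlin _; rewrite count_uniq_mem //.
  by rewrite mem_cat x_xs.
pose L := GRing.isLinear.Build _ _ _ _ _ lin.
pose g : {linear A -> A} := HB.pack (fun v => teval (upd nu x v) f) L.
have [c nux] := e_span (nu x).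
have -> : teval nu f = g (nu x) by rewrite /= upd_id.
rewrite nux linear_sum big_seq big1 // => w we.
rewrite linearZ /= IHs ?scaler0 // => [y ys'|y y_xs y_s].
  by apply: s_xs; rewrite inE ys' orbT.
rewrite /upd; case: eqP => // /eqP yx; apply: nu_e => //.
by rewrite inE negb_or yx.
Qed.

End CapelliSound.

(** * The generators are identities of D2 *)

Section D2Identities.
Variables (F : fieldType) (alpha beta : F).
Local Notation D := (D2 alpha beta).

Lemma r_poly_D2 (a b : D) : (r_poly alpha beta a b).1 = 0.
Proof.
case: a b => [a1 a2] [b1 b2].
rewrite /r_poly /tr /= /D2_tr /= /GRing.scale /= !mulr1.
ring.
Qed.

Lemma s_poly_D2 (a b : D) : (s_poly alpha beta a b).2 = 0.
Proof.
case: a b => [a1 a2] [b1 b2].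
rewrite /s_poly /tr /= /D2_tr /= /GRing.scale /= !mulr1.
ring.
Qed.

Lemma tr1_D2 : tr (1 : D) = (alpha + beta)%:A.
Proof. by rewrite /tr /= /D2_tr /= !mulr1. Qed.

Lemma D2_span (v : D) :
  exists c : D -> F, v = \sum_(w <- [:: (1, 0); (0, 1)]) c w *: w.
Proof.
case: v => v1 v2; exists (fun w => if w.1 == 0 then v2 else v1).
rewrite !big_cons big_nil addr0 /= eqxx oner_eq0.
have coordE (u w : F) : u = u * 1 + w * 0 by rewrite mulr1 mulr0 addr0.
by congr pair; [exact: coordE | rewrite addrC; exact: coordE].
Qed.

Lemma rs_D2 (a b c d : D) : r_poly alpha beta a b * s_poly alpha beta c d = 0.
Proof.
have mulE (u v : D) : u * v = (u.1 * v.1, u.2 * v.2) by [].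
by rewrite mulE r_poly_D2 s_poly_D2 mul0r mulr0.
Qed.

End D2Identities.

Lemma pow_D2 (F : finFieldType) (alpha beta : F) (a : D2 alpha beta) :
  a ^+ #|F| = a.
Proof.
have powE n : a ^+ n = (a.1 ^+ n, a.2 ^+ n) :> D2 alpha beta.
  by elim: n => // n IHn; rewrite !exprS IHn.
by rewrite powE; case: a {powE} => a1 a2 /=; congr pair; exact: (@expf_card F _).
Qed.

Section PolynomialEvaluation.
Variables (F : fieldType) (X : Type) (A : traceAlgType F) (nu : X -> A).

Lemma teval_r_poly (alpha beta : F) (f g : freeTrace F X) :
  teval nu (r_poly alpha beta f g) = r_poly alpha beta (teval nu f) (teval nu g).
Proof.
by rewrite /r_poly !(raddfB, raddfD) /= !linearZ /= !rmorphM /= !teval_tr !rmorphM.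
Qed.

Lemma teval_s_poly (alpha beta : F) (f g : freeTrace F X) :
  teval nu (s_poly alpha beta f g) = s_poly alpha beta (teval nu f) (teval nu g).
Proof. by rewrite !s_polyE teval_r_poly. Qed.

End PolynomialEvaluation.

(** * The identities of D2 *)

Theorem theorem18 (F : finFieldType) (X : eqType) (x : nat -> X)
    (x_inj : injective x) (alpha beta : F) (neq_ab : alpha != beta)
    (alpha_neq0 : alpha != 0) (beta_neq0 : beta != 0) :
  Id X (D2 alpha beta) =
  T_ideal_gen
    ([set r_poly alpha beta (var F (x 1%N)) (var F (x 2%N))
          * s_poly alpha beta (var F (x 3%N)) (var F (x 4%N))]
     `|` [set tr 1 - (alpha + beta)%:A]
     `|` [set var F (x 1%N) ^+ #|F| - var F (x 1%N)]
     `|` [set f | capelli 3 f]).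
Proof.
apply/seteqP; split=> f; last first.
  apply; split; first exact: Id_T_ideal.
  move=> g [[[->|->]|->]|g_cap] => [nu|nu|nu|] /=.
  - by rewrite rmorphM /= teval_r_poly teval_s_poly rs_D2.
  - by rewrite rmorphB /= teval_tr linearZ /= rmorph1 tr1_D2 subrr.
  - by rewrite rmorphB rmorphXn /= pow_D2 subrr.
  - by apply: capelli_Id g_cap; first exact: D2_span.
move=> f0 I [[I0 ID IM Itr Iphi] SI]; apply: contrapT => nIf.
have idI : ideal I by split.
have Isubst (mu : X -> freeTrace F X) g : I g -> I (teval mu g).
  by apply: Iphi => h; apply: teval_tr.
have Ipow a : I (a ^+ #|F| - a).
  have := Isubst (fun=> a) (var F (x 1%N) ^+ #|F| - var F (x 1%N)).
  by rewrite rmorphB rmorphXn /= teval_var; apply; apply: SI; left; right.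
have Irs a b c d : I (r_poly alpha beta a b * s_poly alpha beta c d).
  pose mu z := if z == x 1%N then a else if z == x 2%N then b else
    if z == x 3%N then c else d.
  have := Isubst mu (r_poly alpha beta (var F (x 1%N)) (var F (x 2%N))
          * s_poly alpha beta (var F (x 3%N)) (var F (x 4%N))).
  rewrite rmorphM /= teval_r_poly teval_s_poly !teval_var /mu.
  by rewrite !(inj_eq x_inj) /=; apply; apply: SI; left; left; left.
have [chi chiI chif] := exists_character idI Ipow nIf.
have chi_tr1 : chi (tr 1) = alpha + beta.
  have /chiI : I (tr 1 - (alpha + beta)%:A) by apply: SI; left; left; right.
  rewrite rmorphB /= linearZ /= rmorph1.
  by move=> /eqP; rewrite subr_eq0 => /eqP ->; apply: mulr1.
have [chi_r|[a [b chi_rab]]] : (forall a b, chi (r_poly alpha beta a b) = 0) \/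
    exists a b, chi (r_poly alpha beta a b) != 0.
- have [|/existsNP[a /existsNP[b /eqP rab]]] :=
    pselect (forall a b, chi (r_poly alpha beta a b) = 0); first by left.
  by right; exists a, b.
- have [psi psiP] := trace_character beta_neq0 chi_tr1 chi_r.
  have psi_tr g := (psiP g).2.
  by have [] := Id_D2_characters (fun g => (psiP g).1) psi_tr f0.
(* One nonzero value of r under chi forces all values of s to vanish. *)
have chi_s c d : chi (r_poly beta alpha c d) = 0.
  rewrite -s_polyE; apply: (mulfI chi_rab).
  by rewrite mulr0 -[LHS](rmorphM chi); apply: chiI.
(* Now psi carries the weight alpha, so chi is the second coordinate. *)
rewrite addrC in chi_tr1.
have [psi psiP] := trace_character alpha_neq0 chi_tr1 chi_s.
have psi_tr g : psi (tr g) = alpha * psi g + beta * chi g.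
  by rewrite (psiP g).2 (psiP g).1 addrC.
have chi_tr g : chi (tr g) = psi (tr g) by rewrite (psiP g).2.
by have [] := Id_D2_characters psi_tr chi_tr f0.
Qed.
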